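(* Let $A$ be an abelian group, $G$ a finite group, and $(K,\psi,a)\in\mathcal{T}(G)$. Consider the primitive idempotent $e_{K,\psi,a}$ of $\mathbb{Q}\otimes_{\mathbb Z}\mathcal{D}^A_\omega(G)$ corresponding to the $G$-conjugacy class of $(K,\psi,a)$. Then the conductor of $e_{K,\psi,a}$ into $\mathcal{D}^A_\omega(G)$ is $|N_G(K,\psi,a)|$, where $N_G(K,\psi,a)$ is the stabilizer of the triple $(K,\psi,a)$ in $G$.
   Context: $A$ is an abelian group, $G$ a finite group; modules are finite-dimensional. An $A$-fibered $G$-set is a left $A\times G$-set $X$ that is free as an $A$-set and has finitely many $A$-orbits; morphisms are $A\times G$-equivariant maps. $X/A$ is the $G$-set of $A$-orbits. For $x\in X$, $G_x\le G$ is the stabilizer of the $A$-orbit of $x$ and $\phi_x\colon G_x\to A$ is the homomorphism with $gx=\phi_x(g)x$ for $g\in G_x$; the pair $(G_x,\phi_x)$ depends only on the $A$-orbit of $x$. $X\otimes_A Y$ is the quotient of $X\times Y$ by $(ax,y)\sim(x,ay)$, with $A$ acting through either factor and $G$ acting diagonally; its $A$-orbits correspond to $X/A\times Y/A$. A $\mathbb{C}G$-module $V$ is $X/A$-graded if $V=\bigoplus_{x\in X/A}V_x$ with subspaces satisfying $gV_x=V_{gx}$ for all $g\in G$. Consider the category of pairs $(X,V)$ with $X$ an $A$-fibered $G$-set and $V$ an $X/A$-graded $\mathbb{C}G$-module; a morphism $(X,V)\to(Y,W)$ is a pair $(\alpha,f)$ with $\alpha$ a morphism of $A$-fibered $G$-sets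 and $f$ a $\mathbb{C}G$-homomorphism with $f(V_x)\subseteq W_{\alpha(x)}$. $T^A(G)$ is the Grothendieck group of isomorphism classes $[X,V]$ with respect to $(X,V)\oplus(Y,W)=(X\sqcup Y,V\oplus W)$. The global $A$-fibered representation ring $\mathcal{D}^A(G)$ is the quotient of $T^A(G)$ by the subgroup generated by all $[X,V\oplus W]-[X,V]-[X,W]$, with product $[X,V]\cdot[Y,W]=[X\otimes_AY,V\otimes_{\mathbb C}W]$, where $(V\otimes W)_{x\otimes y}=V_x\otimes W_y$. $\mathcal{M}^A(G)=\{(H,\phi)\mid H\le G,\ \phi\in\mathrm{Hom}(H,A)\}$ is a poset under $(H,\phi)\le(K,\psi)$ iff $H\le K$ and $\psi|_H=\phi$; $G$ acts by conjugation, ${}^gH=gHg^{-1}$, ${}^g\phi(ghg^{-1})=\phi(h)$, and $N_G(H,\phi)$ is the stabilizer of $(H,\phi)$. $\mathcal{T}(G)=\{(H,\psi,a)\mid (H,\psi)\in\mathcal{M}^A(G),\ a\in H\}$, on which $G$ acts by conjugation; $N_G(K,\psi,a)=N_G(K,\psi)\cap C_G(a)$. For $(H,\phi)\in\mathcal{M}^A(G)$ and a $\mathbb{C}H$-module $W$, $[H,\phi,W]_G\in\mathcal{D}^A(G)$ is the class of $(X,\mathbb{C}G\otimes_{\mathbb{C}H}W)$, where $X$ is the transitive $A$-fibered $G$-set having an element $x_0$ with $(G_{x_0},\phi_{x_0})=(H,\phi)$, and the component of the $A$-orbit of $gx_0$ is $g\otimes W$. Let $\omega$ be a primitive complex $|G|$-th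 root of unity and $\mathcal{D}^A_\omega(G)=\mathbb{Z}[\omega]\otimes_{\mathbb Z}\mathcal{D}^A(G)$. For $(K,\psi,a)\in\mathcal{T}(G)$, define in $\mathbb{Q}\otimes_{\mathbb Z}\mathcal{D}^A_\omega(G)=\mathbb{Q}[\omega]\otimes_{\mathbb Z}\mathcal{D}^A(G)$ $$e_{K,\psi,a}=\frac{1}{|N_G(K,\psi)\cap C_G(a)|}\sum_{\langle a\rangle\le H\le K}\ \sum_{S\in\mathrm{Irr}(H)}\mu\big((H,\psi|_H),(K,\psi)\big)\,\overline{\chi_S(a)}\,[H,\psi|_H,S]_G,$$ where $\mu$ is the Möbius function of the poset $\mathcal{M}^A(G)$, $\mathrm{Irr}(H)$ is the set of isomorphism classes of simple $\mathbb{C}H$-modules, and the bar is complex conjugation. The conductor of an element $e$ of $\mathbb{Q}\otimes\mathcal{D}^A_\omega(G)$ into $\mathcal{D}^A_\omega(G)$ is the least positive integer $n$ with $n\,e\in\mathcal{D}^A_\omega(G)$. *)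

(* Defs.v *)
From HB Require Import structures.
From mathcomp Require Import all_boot all_order all_fingroup all_algebra.
From mathcomp Require Import ring_quotient cyclic mxrepresentation.
From mathcomp Require Import boolp classical_sets cardinality fsbigop reals.
From mathcomp Require Import freeg complex.

Set Implicit Arguments.
Unset Strict Implicit.
Unset Printing Implicit Defensive.

Import Order.TTheory GRing.Theory Num.Theory.

Local Open Scope ring_scope.

Section SubgroupQuotient.
Variables (M : zmodType) (S : M -> Prop).

Definition subgroup_gen : M -> bool := fun x =>
  `[< forall P : M -> Prop, P 0 -> (forall u v, P u -> P v -> P (u - v)) ->
      (forall s, S s -> P s) -> P x >].

Fact subgroup_gen_closed : zmod_closed subgroup_gen.
Proof.
split=> [|x y /asboolP Px /asboolP Py]; apply/asboolP => P P0 PB PS //.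
by apply: (PB); [apply: Px | apply: Py].
Qed.

HB.instance Definition _ :=
  GRing.isZmodClosed.Build M subgroup_gen subgroup_gen_closed.

Definition zquot : Type :=
  Quotient.quot (GRing.ZmodClosed.clone M subgroup_gen _).
HB.instance Definition _ := GRing.Zmodule.on zquot.

Definition zproj (x : M) : zquot := (\pi_zquot x)%qT.

End SubgroupQuotient.

Definition fgen (K : choiceType) (k : K) : {freeg K} := Freeg [:: (1%:Z, k)].

Inductive tensor_rel (U V : zmodType) : {freeg (U * V)} -> Prop :=
| TensorDl u1 u2 v :
    tensor_rel (fgen (u1 + u2, v) - fgen (u1, v) - fgen (u2, v))
| TensorDr u v1 v2 :
    tensor_rel (fgen (u, v1 + v2) - fgen (u, v1) - fgen (u, v2)).

Definition tensor (U V : zmodType) : zmodType := zquot (@tensor_rel U V).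
Definition tens (U V : zmodType) (u : U) (v : V) : tensor U V :=
  zproj (@tensor_rel U V) (fgen (u, v)).

Definition is_conductor (L M : zmodType) (iota : L -> M) (x : M) (n : nat) :=
  [/\ (0 < n)%N, exists y, x *+ n = iota y &
      forall m, (0 < m)%N -> (exists y, x *+ m = iota y) -> (n <= m)%N].

Section Adjunction.
Variables (R : comNzRingType) (w : R).

Definition Zadj : R -> bool :=
  fun x => `[< exists p : {poly int}, x = (map_poly intr p).[w] >].

Fact Zadj_subring_closed : subring_closed Zadj.
Proof.
split=> [|x y /asboolP[p ->] /asboolP[q ->]|x y /asboolP[p ->] /asboolP[q ->]].
- by apply/asboolP; exists 1; rewrite rmorph1 hornerC.
- by apply/asboolP; exists (p - q); rewrite rmorphB !hornerE.
- by apply/asboolP; exists (p * q); rewrite rmorphM hornerM.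
Qed.

HB.instance Definition _ :=
  GRing.isSubringClosed.Build R Zadj Zadj_subring_closed.

Record Zext := ZExt { zext_val : R; zext_valP : zext_val \in Zadj }.

HB.instance Definition _ := [isSub for zext_val].
HB.instance Definition _ := [Choice of Zext by <:].
HB.instance Definition _ := [SubChoice_isSubComNzRing of Zext by <:].

Lemma Zadj_gen : w \in Zadj.
Proof. by apply/asboolP; exists 'X; rewrite map_polyX hornerX. Qed.

End Adjunction.

Section Moebius.
Local Open Scope classical_set_scope.
Variables (d : Order.disp_t) (T : porderType d).

(* The recursion mu(x, x) = 1 and mu(x, y) = - \sum_(x <= z < y) mu(x, z) for
   x < y, with [n] bounding the length of the chains below [y]. *)
Fixpoint moebius_rec (n : nat) (x y : T) : int :=
  if n is n'.+1 then
    if x == y then 1 else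
    if (x < y)%O then - \sum_(z \in [set z | (x <= z < y)%O]) moebius_rec n' x z
    else 0
  else 0.

End Moebius.

Section MonomialPoset.
Variables (A : zmodType) (gT : finGroupType).
Implicit Types (H K L : {group gT}) (g x : gT).

(* A homomorphism H -> A is stored as a function on gT that vanishes off H, so
   that equality of homomorphisms is Leibniz equality. *)
Definition is_hom H (f : {ffun gT -> A}) : bool :=
  [forall x in H, forall y in H, f (x * y)%g == f x + f y]
  && [forall x, (x \notin H) ==> (f x == 0)].

Definition mpair : Type := {p : {group gT} * {ffun gT -> A} | is_hom p.1 p.2}.
HB.instance Definition _ := Choice.on mpair.

Definition mgrp (p : mpair) : {group gT} := (val p).1.
Definition mhom (p : mpair) : {ffun gT -> A} := (val p).2.

Lemma mhomM (p : mpair) :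
  {in mgrp p &, forall x y, mhom p (x * y)%g = mhom p x + mhom p y}.
Proof.
move=> x y xK yK; case/andP: (valP p) => /forall_inP/(_ x xK) + _.
by move=> /forall_inP/(_ y yK)/eqP.
Qed.

Lemma mhom_out (p : mpair) x : x \notin mgrp p -> mhom p x = 0.
Proof. by case/andP: (valP p) => _ /forallP/(_ x)/implyP + xK => /(_ xK)/eqP. Qed.

Lemma mhom1 (p : mpair) : mhom p 1%g = 0.
Proof.
have := mhomM (group1 (mgrp p)) (group1 (mgrp p)).
by rewrite mulg1 => /esym/(canRL (addKr _)); rewrite addNr.
Qed.

Lemma is_homP H (f : gT -> A) : {in H &, forall x y, f (x * y)%g = f x + f y} ->
  is_hom H [ffun x => if x \in H then f x else 0].
Proof.
move=> fM; apply/andP; split; last first.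
  by apply/forallP => x; apply/implyP => /negbTE xH; rewrite ffunE xH.
apply/forall_inP => x xH; apply/forall_inP => y yH.
by rewrite !ffunE groupM // xH yH fM.
Qed.

Definition MPair H (f : gT -> A)
    (fM : {in H &, forall x y, f (x * y)%g = f x + f y}) : mpair :=
  exist _ (H, [ffun x => if x \in H then f x else 0]) (is_homP fM).

Lemma mpair_eqP (p q : mpair) :
  mgrp p = mgrp q -> {in mgrp p, mhom p =1 mhom q} -> p = q.
Proof.
move=> eqG eqh; apply/val_inj; rewrite [LHS]surjective_pairing.
rewrite [RHS]surjective_pairing -!/(mgrp _) -!/(mhom _) eqG; congr (_, _).
apply/ffunP => x; have [xp|xp] := boolP (x \in mgrp p); first exact: eqh.
by rewrite !mhom_out -?eqG.
Qed.

Definition mle (p q : mpair) : bool :=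
  (mgrp p \subset mgrp q) && [forall x in mgrp p, mhom q x == mhom p x].

Lemma mleP (p q : mpair) :
  reflect (mgrp p \subset mgrp q /\ {in mgrp p, mhom q =1 mhom p}) (mle p q).
Proof.
apply: (iffP andP) => -[sKL e]; split=> //.
  by move=> x xK; apply/eqP; have /forall_inP -> := e.
by apply/forall_inP => x xK; rewrite e.
Qed.

Fact mle_refl : reflexive mle.
Proof. by move=> p; apply/mleP. Qed.

Fact mle_anti : antisymmetric mle.
Proof.
move=> p q /andP[/mleP[s e] /mleP[s' _]]; apply: mpair_eqP.
  by apply/val_inj/eqP; rewrite finset.eqEsubset s.
by move=> x xp; rewrite e.
Qed.

Fact mle_trans : transitive mle.
Proof.
move=> q p r /mleP[s e] /mleP[s' e']; apply/mleP; split.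
  exact: fintype.subset_trans s s'.
by move=> x xp; rewrite e' ?e //; apply: (fintype.subsetP s).
Qed.

Fact mpair_display : Order.disp_t. Proof. exact: Order.Disp tt tt. Qed.
HB.instance Definition _ :=
  Order.Le_isPOrder.Build mpair_display mpair mle_refl mle_anti mle_trans.

Definition mres (p : mpair) H (sHK : H \subset mgrp p) : mpair :=
  @MPair H (mhom p) (sub_in2 (fintype.subsetP sHK) (@mhomM p)).

(* Conjugation: g.(H, phi) = (gHg^-1, phi^g) with phi^g (x) = phi (g^-1 x g);
   recall that H :^ y = y^-1 H y and x ^ y = y^-1 x y. *)
Fact mconj_subproof g (p : mpair) : {in (mgrp p :^ g^-1)%G &,
  forall x y, mhom p ((x * y) ^ g)%g = mhom p (x ^ g)%g + mhom p (y ^ g)%g}.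
Proof. by move=> x y; rewrite !mem_conjgV => xK yK; rewrite conjMg mhomM. Qed.

Definition mconj g (p : mpair) : mpair := MPair (mconj_subproof (g := g) (p := p)).

Definition mnorm (p : mpair) : {set gT} := [set g | mconj g p == p].

Definition tnorm (p : mpair) (a : gT) : {set gT} :=
  [set g | (mconj g p == p) && (g * a * g^-1 == a)%g].

(* A chain below [q] has at most #|mgrp q| elements; see [mmoebiusE]. *)
Definition mmoebius (p q : mpair) : int := moebius_rec #|mgrp q| p q.

Local Open Scope classical_set_scope.

Lemma mlt_card (p q : mpair) : (p < q)%O -> (#|mgrp p| < #|mgrp q|)%N.
Proof.
rewrite lt_neqAle => /andP[npq /mleP[s e]]; apply: proper_card.
rewrite finset.properEneq s andbT; apply: contraNneq npq => eqG.
by apply/eqP/mpair_eqP => [|x xp]; [apply/val_inj | rewrite e].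
Qed.

Lemma finite_mle (q : mpair) : finite_set [set p : mpair | (p <= q)%O].
Proof.
pose f L : mpair := mres (finset.subsetIr L (mgrp q)).
apply: sub_finite_set (finite_image f (@finite_finset {group gT} setT)).
move=> p /mleP[s e]; exists (mgrp p) => //; apply: mpair_eqP => /=.
  by apply/val_inj/finset.setIidPl.
move=> x xpq; rewrite [LHS]ffunE xpq e //.
by move: xpq; rewrite inE => /andP[].
Qed.

Lemma mmoebiusE (p q : mpair) : mmoebius p q =
  if p == q then 1 else
  if (p < q)%O then - \sum_(r \in [set r | (p <= r < q)%O]) mmoebius p r else 0.
Proof.
have fuel n m r : (#|mgrp r| <= n)%N -> (#|mgrp r| <= m)%N ->
    moebius_rec n p r = moebius_rec m p r.
  elim: n m r => [|n IH] [|m] r rn rm;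
    try by rewrite leqNgt cardG_gt0 in rn.
    by rewrite leqNgt cardG_gt0 in rm.
  rewrite /=; case: ifP => // _; case: ifP => // _; congr (- _).
  apply: eq_fsbigr => z; rewrite inE /= => /andP[_ /mlt_card zr].
  by apply: IH; rewrite -ltnS (leq_trans zr).
rewrite /mmoebius (fuel _ #|mgrp q|.+1) //=.
case: ifP => // _; case: ifP => // _; congr (- _).
apply: eq_fsbigr => z; rewrite inE /= => /andP[_ /mlt_card/ltnW zq].
exact: fuel.
Qed.

End MonomialPoset.

Section FiberedSets.
Variables (A : zmodType) (gT : finGroupType).

(* [fiber_fin]: the A-orbits of finitely many elements cover the set. *)
Record fibered_set : Type := FiberedSet {
  fiber_car :> Type;
  fiber_A : A -> fiber_car -> fiber_car;
  fiber_G : gT -> fiber_car -> fiber_car;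
  fiber_A0 : forall x, fiber_A 0 x = x;
  fiber_AD : forall a b x, fiber_A (a + b) x = fiber_A a (fiber_A b x);
  fiber_G1 : forall x, fiber_G 1%g x = x;
  fiber_GM : forall g h x, fiber_G (g * h)%g x = fiber_G g (fiber_G h x);
  fiber_GA : forall g a x, fiber_G g (fiber_A a x) = fiber_A a (fiber_G g x);
  fiber_free : forall a x, fiber_A a x = x -> a = 0;
  fiber_fin : exists n (r : 'I_n -> fiber_car),
    forall x, exists i, exists a, x = fiber_A a (r i)
}.

Record fibered_mor (X Y : fibered_set) : Type := FiberedMor {
  fibered_fun :> X -> Y;
  fibered_funA : forall a x, fibered_fun (fiber_A a x) = fiber_A a (fibered_fun x);
  fibered_funG : forall g x, fibered_fun (fiber_G g x) = fiber_G g (fibered_fun x)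
}.

Definition fibered_iso (X Y : fibered_set) : Prop :=
  exists (f : fibered_mor X Y) (f' : fibered_mor Y X), cancel f f' /\ cancel f' f.

(* Isomorphism classes of A-fibered G-sets form a set: a free A-set with n
   orbits is isomorphic to A x {0, ..., n-1} with A translating the first
   factor.  [fibset] is the type of A-fibered G-sets with such an underlying
   A-set; by [fibset_complete] it meets every isomorphism class.  The set of
   A-orbits of [X : fibset] is 'I_(norb X), the orbit of [x] being [x.2]. *)
Record fibset : Type := FibSet {
  norb : nat;
  fact : gT -> A * 'I_norb -> A * 'I_norb;
  fact1 : forall x, fact 1%g x = x;
  factM : forall g h x, fact (g * h)%g x = fact g (fact h x);
  factA : forall g a x,
    fact g (a + x.1, x.2) = (a + (fact g x).1, (fact g x).2)
}.

Section FiberedOfFibset.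
Variable X : fibset.
Implicit Type x : A * 'I_(norb X).

Let trans (a : A) x := (a + x.1, x.2).

Fact fibset_A0 x : trans 0 x = x.
Proof. by rewrite /trans add0r -surjective_pairing. Qed.

Fact fibset_AD a b x : trans (a + b) x = trans a (trans b x).
Proof. by rewrite /trans addrA. Qed.

Fact fibset_free a x : trans a x = x -> a = 0.
Proof. by case: x => b i [/(canRL (addrK _))]; rewrite subrr. Qed.

Fact fibset_fin : exists n (r : 'I_n -> A * 'I_(norb X)),
  forall x, exists i, exists a, x = trans a (r i).
Proof.
exists (norb X), (pair 0) => -[a i]; exists i, a.
by rewrite /trans addr0.
Qed.

Definition fibered_of_fibset : fibered_set :=
  FiberedSet fibset_A0 fibset_AD (@fact1 X) (@factM X) (@factA X)
    fibset_free fibset_fin.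

End FiberedOfFibset.

Lemma fibset_complete (X : fibered_set) :
  exists Y : fibset, fibered_iso X (fibered_of_fibset Y).
Proof.
pose P n := `[< exists r : 'I_n -> X,
  forall x, exists i, exists a, x = fiber_A a (r i) >].
have exP : exists n, P n.
  by have [n [r rP]] := fiber_fin X; exists n; apply/asboolP; exists r.
case: (ex_minnP exP) => n /asboolP[r rP] n_min.
have r_inj i j a : r i = fiber_A a (r j) -> i = j.
  case: n i j r rP n_min => [[]//|n] i j r rP n_min rij.
  apply: contrapT => /eqP nij; suff: P n by move/n_min; rewrite ltnn.
  apply/asboolP; exists (r \o fintype.lift i) => x.
  have [k [b ->]] := rP x; case: (unliftP i k) => [k' ->|->]; first by exists k', b.
  case: (unliftP i j) nij => [j' ej _|->]; last by rewrite eqxx.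
  by exists j', (b + a); rewrite rij ej fiber_AD.
have exi x : exists y : A * 'I_n, x = fiber_A y.1 (r y.2).
  by have [i [a xE]] := rP x; exists (a, i).
have [phi phiP] := boolp.choice exi.
pose psi (x : A * 'I_n) := fiber_A x.1 (r x.2).
have phiK : cancel phi psi by move=> x; exact: (esym (phiP x)).
have psi_inj : injective psi.
  move=> [a i] [b j]; rewrite /psi /= => e.
  have rE : r i = fiber_A (- a + b) (r j).
    by rewrite fiber_AD -e -fiber_AD addNr fiber_A0.
  have ij := r_inj _ _ _ rE; rewrite -ij in rE *.
  by have /eqP := fiber_free (esym rE); rewrite addrC subr_eq0 => /eqP ->.
have psiK : cancel psi phi by move=> x; apply: psi_inj; rewrite phiK.
pose act g x := phi (fiber_G g (psi x)).
have act1 x : act 1%g x = x by rewrite /act fiber_G1.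
have actM g h x : act (g * h)%g x = act g (act h x).
  by rewrite /act phiK fiber_GM.
have psiA a x : psi (a + x.1, x.2) = fiber_A a (psi x) by rewrite /psi fiber_AD.
have actA g a x : act g (a + x.1, x.2) = (a + (act g x).1, (act g x).2).
  by apply: psi_inj; rewrite /act phiK !psiA fiber_GA phiK.
pose Y := FibSet act1 actM actA; exists Y.
have phiA a x : phi (fiber_A a x) = fiber_A (f := fibered_of_fibset Y) a (phi x).
  by apply: psi_inj; rewrite phiK psiA phiK.
have phiG g x : phi (fiber_G g x) = act g (phi x) by rewrite /act phiK.
have psiG g x : psi (act g x) = fiber_G g (psi x) by rewrite /act phiK.
exists (@FiberedMor X (fibered_of_fibset Y) phi phiA phiG).
by exists (@FiberedMor (fibered_of_fibset Y) X psi psiA psiG).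
Qed.

Definition oact (X : fibset) (g : gT) (i : 'I_(norb X)) : 'I_(norb X) :=
  (fact g (0, i)).2.

Lemma oactE (X : fibset) g x : (fact (f := X) g x).2 = oact g x.2.
Proof.
by case: x => a i; have := factA (f := X) g a (0, i); rewrite /= addr0 => ->.
Qed.

Section DisjointUnion.
Variables X Y : fibset.

Definition fsum_act g (x : A * 'I_(norb X + norb Y)) :
    A * 'I_(norb X + norb Y) :=
  match split x.2 with
  | inl i => let y := fact g (x.1, i) in (y.1, lshift (norb Y) y.2)
  | inr j => let y := fact g (x.1, j) in (y.1, rshift (norb X) y.2)
  end.

Let split_l i : split (lshift (norb Y) i) = inl i :> 'I_(norb X) + 'I_(norb Y).
Proof. exact: (unsplitK (inl i)). Qed.

Let split_r i : split (rshift (norb X) i) = inr i :> 'I_(norb X) + 'I_(norb Y).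
Proof. exact: (unsplitK (inr i)). Qed.

Fact fsum_act1 x : fsum_act 1%g x = x.
Proof.
by case: x => a i; rewrite /fsum_act /=; case: splitP => j ij;
  rewrite fact1; congr (_, _); apply/val_inj.
Qed.

Fact fsum_actM g h x : fsum_act (g * h)%g x = fsum_act g (fsum_act h x).
Proof.
case: x => a i; rewrite /fsum_act /=; case: split => j /=.
  by rewrite split_l factM -surjective_pairing.
by rewrite split_r factM -surjective_pairing.
Qed.

Fact fsum_actA g a x :
  fsum_act g (a + x.1, x.2) = (a + (fsum_act g x).1, (fsum_act g x).2).
Proof.
case: x => b i; rewrite /fsum_act /=; case: split => j /=.
  by have /= -> := factA (f := X) g a (b, j).
by have /= -> := factA (f := Y) g a (b, j).
Qed.

Definition fsum : fibset := FibSet fsum_act1 fsum_actM fsum_actA.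

Lemma oact_lshift g i : oact (X := fsum) g (lshift _ i) = lshift _ (oact g i).
Proof. by rewrite /oact /= /fsum_act /= split_l. Qed.

Lemma oact_rshift g i : oact (X := fsum) g (rshift _ i) = rshift _ (oact g i).
Proof. by rewrite /oact /= /fsum_act /= split_r. Qed.

End DisjointUnion.
End FiberedSets.

Coercion fibered_of_fibset : fibset >-> fibered_set.

Section GradedModules.
Variables (C : fieldType) (A : zmodType) (gT : finGroupType).
Local Notation G := [set: gT]%g.

(* A matrix acting on column vectors from the left.  A matrix representation
   r : gT -> 'M_n is the left module 'cV_n with g v := r g *m v. *)
Definition mxhom m n (M : 'M[C]_(m, n)) : 'Hom('cV[C]_n, 'cV[C]_m) :=
  linfun (mulmx M).

Lemma mxhomE m n (M : 'M[C]_(m, n)) v : mxhom M v = M *m v.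
Proof. by rewrite lfunE. Qed.

Lemma mxhom_comp m n p (M : 'M[C]_(m, n)) (N : 'M[C]_(n, p)) U :
  (mxhom (M *m N) @: U = mxhom M @: (mxhom N @: U))%VS.
Proof.
rewrite -limg_comp; congr (_ @: _)%VS; apply/lfunP => v.
by rewrite comp_lfunE !mxhomE mulmxA.
Qed.

Lemma dim_limg_leq (aT rT : vectType C) (f : 'Hom(aT, rT)) U :
  (\dim (f @: U) <= \dim U)%N.
Proof. by rewrite -(limg_ker_dim f U) leq_addl. Qed.

Lemma dim_cV n : \dim {:'cV[C]_n} = n.
Proof. by rewrite dimvf /dim /= muln1. Qed.

Definition direct_decomp n k (V : 'I_k -> {vspace 'cV[C]_n}) : Prop :=
  (\sum_i V i = fullv)%VS /\ directv (\sum_i V i)%VS.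

Lemma direct_decompP n k (V : 'I_k -> {vspace 'cV[C]_n}) :
  (\sum_i V i = fullv)%VS -> (\sum_i \dim (V i) <= n)%N -> direct_decomp V.
Proof.
move=> sumV le_n; split=> //; rewrite directvE /= eqn_leq dimv_sum_leqif andTb.
by rewrite sumV dim_cV.
Qed.

Record grmod (X : fibset A gT) : Type := GrMod {
  gdim : nat;
  grep : mx_representation C G gdim;
  gcomp : 'I_(norb X) -> {vspace 'cV[C]_gdim};
  gcomp_direct : direct_decomp gcomp;
  gcompG : forall g i, (mxhom (grep g) @: gcomp i)%VS = gcomp (oact g i)
}.

Lemma gcomp_full X (V : grmod X) : (\sum_i gcomp V i = fullv)%VS.
Proof. by case: (gcomp_direct V). Qed.

Lemma gcomp_dim X (V : grmod X) : (\sum_i \dim (gcomp V i))%N = gdim V.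
Proof.
by have [] := gcomp_direct V; rewrite directvE /= => ->; rewrite dim_cV => /eqP.
Qed.

Record grpair : Type := GrPair { gset : fibset A gT; gmod : grmod gset }.

Record grpair_mor (P Q : grpair) : Type := GrPairMor {
  mor_set : fibered_mor (gset P) (gset Q);
  mor_mod : 'M[C]_(gdim (gmod Q), gdim (gmod P));
  mor_modG : forall g : gT,
    mor_mod *m grep (gmod P) g = grep (gmod Q) g *m mor_mod;
  mor_comp : forall x : gset P,
    (mxhom mor_mod @: gcomp (gmod P) x.2 <= gcomp (gmod Q) (mor_set x).2)%VS
}.

Definition grpair_iso (P Q : grpair) : Prop :=
  exists (f : grpair_mor P Q) (f' : grpair_mor Q P),
    [/\ cancel (mor_set f) (mor_set f'), cancel (mor_set f') (mor_set f),
        mor_mod f' *m mor_mod f = 1%:M & mor_mod f *m mor_mod f' = 1%:M].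

Section DirectSum.
Variables m n : nat.
Variables (rV : mx_representation C G m) (rW : mx_representation C G n).

Fact block_mx_repr : mx_repr G (fun g => block_mx (rV g) 0 0 (rW g)).
Proof.
split=> [|g h gG hG]; first by rewrite !repr_mx1 -scalar_mx_block.
by rewrite mulmx_block !(mulmx0, mul0mx, addr0, add0r) !repr_mxM.
Qed.

Definition dsum_repr : mx_representation C G (m + n) :=
  MxRepresentation block_mx_repr.

Definition dsum_inl : 'M[C]_(m + n, m) := col_mx 1%:M 0.
Definition dsum_inr : 'M[C]_(m + n, n) := col_mx 0 1%:M.

Lemma dsum_reprl g : dsum_repr g *m dsum_inl = dsum_inl *m rV g.
Proof.
by rewrite mul_block_col mul_col_mx !(mulmx0, mul0mx, mul1mx, mulmx1, addr0).
Qed.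

Lemma dsum_reprr g : dsum_repr g *m dsum_inr = dsum_inr *m rW g.
Proof.
by rewrite mul_block_col mul_col_mx !(mulmx0, mul0mx, mul1mx, mulmx1, add0r).
Qed.

Lemma dsum_full :
  (mxhom dsum_inl @: fullv + mxhom dsum_inr @: fullv = fullv)%VS.
Proof.
apply/vspaceP => v; rewrite memvf.
have -> : v = mxhom dsum_inl (usubmx v) + mxhom dsum_inr (dsubmx v).
  rewrite !mxhomE !mul_col_mx !(mul0mx, mul1mx) add_col_mx addr0 add0r.
  by rewrite vsubmxK.
by apply: memv_add; apply: memv_img; apply: memvf.
Qed.

End DirectSum.

Section PairSum.
Variables P Q : grpair.
Let V := gmod P.
Let W := gmod Q.

Definition psum_comp (i : 'I_(norb (gset P) + norb (gset Q))) :
    {vspace 'cV[C]_(gdim V + gdim W)} :=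
  match split i with
  | inl j => mxhom (dsum_inl _ _) @: gcomp V j
  | inr j => mxhom (dsum_inr _ _) @: gcomp W j
  end%VS.

Let psum_compl j : psum_comp (lshift _ j) = (mxhom (dsum_inl _ _) @: gcomp V j)%VS.
Proof. by rewrite /psum_comp (unsplitK (inl j)). Qed.

Let psum_compr j : psum_comp (rshift _ j) = (mxhom (dsum_inr _ _) @: gcomp W j)%VS.
Proof. by rewrite /psum_comp (unsplitK (inr j)). Qed.

Fact psum_full : (\sum_i psum_comp i = fullv)%VS.
Proof.
rewrite big_split_ord /=; under eq_bigr do rewrite psum_compl.
under [X in (_ + X)%VS]eq_bigr do rewrite psum_compr.
by rewrite -!limg_sum !gcomp_full dsum_full.
Qed.

Fact psum_direct : direct_decomp psum_comp.
Proof.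
apply: direct_decompP psum_full _; rewrite big_split_ord /=.
rewrite -[X in (_ <= X + _)%N]gcomp_dim
  -[X in (_ <= _ + X)%N]gcomp_dim.
apply: leq_add; apply: leq_sum => i _.
  by rewrite psum_compl dim_limg_leq.
by rewrite psum_compr dim_limg_leq.
Qed.

Fact psum_compG g i : (mxhom (dsum_repr (grep V) (grep W) g) @: psum_comp i)%VS
  = psum_comp (oact (X := fsum (gset P) (gset Q)) g i).
Proof.
rewrite -(splitK i); case: (split i) => j /=.
  by rewrite oact_lshift !psum_compl -mxhom_comp dsum_reprl mxhom_comp gcompG.
by rewrite oact_rshift !psum_compr -mxhom_comp dsum_reprr mxhom_comp gcompG.
Qed.

Definition psum : grpair :=
  GrPair (@GrMod (fsum (gset P) (gset Q)) _ _ _ psum_direct psum_compG).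

End PairSum.

Section ModuleSum.
Variables (X : fibset A gT) (V W : grmod X).

Definition msum_comp (i : 'I_(norb X)) : {vspace 'cV[C]_(gdim V + gdim W)} :=
  (mxhom (dsum_inl _ _) @: gcomp V i + mxhom (dsum_inr _ _) @: gcomp W i)%VS.

Fact msum_full : (\sum_i msum_comp i = fullv)%VS.
Proof. by rewrite big_split /= -!limg_sum !gcomp_full dsum_full. Qed.

Fact msum_direct : direct_decomp msum_comp.
Proof.
apply: direct_decompP msum_full _.
rewrite -[X in (_ <= X + _)%N]gcomp_dim
  -[X in (_ <= _ + X)%N]gcomp_dim.
rewrite -big_split /=; apply: leq_sum => i _.
by apply: leq_trans (dimv_add_leqif _ _) _; apply: leq_add; apply: dim_limg_leq.
Qed.

Fact msum_compG g i : (mxhom (dsum_repr (grep V) (grep W) g) @: msum_comp i)%VS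
  = msum_comp (oact g i).
Proof.
by rewrite limgD -!mxhom_comp dsum_reprl dsum_reprr !mxhom_comp !gcompG.
Qed.

Definition msum : grmod X := GrMod msum_direct msum_compG.

End ModuleSum.

Inductive T_rel : {freeg {classic grpair}} -> Prop :=
| T_iso (P Q : grpair) : grpair_iso P Q ->
    T_rel (fgen (P : {classic grpair}) - fgen (Q : {classic grpair}))
| T_sum (P Q : grpair) :
    T_rel (fgen (psum P Q : {classic grpair})
             - fgen (P : {classic grpair}) - fgen (Q : {classic grpair})).

Definition TA : zmodType := zquot T_rel.
Definition Tcls (X : fibset A gT) (V : grmod X) : TA :=
  zproj T_rel (fgen (GrPair V : {classic grpair})).

Inductive D_rel : TA -> Prop :=
| D_sum (X : fibset A gT) (V W : grmod X) :
    D_rel (Tcls (msum V W) - Tcls V - Tcls W).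

(* Only the additive group of the ring D^A(G) is formed: neither the elements
   e_{K, psi, a} nor conductors involve the product. *)
Definition DA : zmodType := zquot D_rel.
Definition Dcls (X : fibset A gT) (V : grmod X) : DA := zproj D_rel (Tcls V).

End GradedModules.

Section Induction.
Variables (A : zmodType) (gT : finGroupType).
Implicit Types (g h : gT) (p : mpair A gT).

Definition has_stab (X : fibered_set A gT) (x : X) p : Prop :=
  (forall g, (exists a, fiber_G g x = fiber_A a x) <-> g \in mgrp p) /\
  (forall g, g \in mgrp p -> fiber_G g x = fiber_A (mhom p g) x).

Section Transitive.
Variable p : mpair A gT.
Local Notation H := (mgrp p).

Definition ncos : nat := #|lcosets H [set: gT]%g|.

Fact mem_lcos g : (g *: H)%g \in lcosets H [set: gT]%g.
Proof. by apply/lcosetsP; exists g; rewrite ?inE. Qed.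

(* Numbering of the left cosets of H, their representatives, and the element
   [ccoc g] of H with g = crep (cidx g) * ccoc g. *)
Definition cidx g : 'I_ncos := enum_rank_in (mem_lcos 1%g) (g *: H)%g.
Definition crep (i : 'I_ncos) : gT := repr (enum_val i).
Definition ccoc g : gT := ((crep (cidx g))^-1 * g)%g.

Lemma enum_val_cidx g : enum_val (cidx g) = (g *: H)%g.
Proof. by rewrite enum_rankK_in ?mem_lcos. Qed.

Lemma ccoc_in g : ccoc g \in H.
Proof.
have: crep (cidx g) \in (g *: H)%g.
  by rewrite /crep enum_val_cidx (mem_repr g) ?lcoset_refl.
by rewrite mem_lcoset -groupV invMg invgK.
Qed.

Lemma cidxMr g h : h \in H -> cidx (g * h)%g = cidx g.
Proof.
move=> hH; rewrite /cidx; congr (enum_rank_in _ _).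
by rewrite lcosetM lcoset_id.
Qed.

Lemma crep_cidx g : crep (cidx g) = (g * (ccoc g)^-1)%g.
Proof. by rewrite /ccoc invMg invgK mulKVg. Qed.

Lemma cidx_crep i : cidx (crep i) = i.
Proof.
have /lcosetsP[x _ xE] := enum_valP i.
have: crep i \in (x *: H)%g by rewrite /crep xE (mem_repr x) ?lcoset_refl.
case/lcosetP => h hH ->; rewrite cidxMr // /cidx -xE.
exact: enum_valK_in.
Qed.

Lemma crep1 : crep (cidx 1%g) = 1%g.
Proof. by rewrite /crep enum_val_cidx mul1g repr_group. Qed.

Definition coset_act g (x : A * 'I_ncos) : A * 'I_ncos :=
  (x.1 + mhom p (ccoc (g * crep x.2)), cidx (g * crep x.2)).

Lemma cidx_mul g h i :
  cidx (g * h * crep i)%g = cidx (g * crep (cidx (h * crep i)))%g.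
Proof. by rewrite crep_cidx !mulgA [RHS]cidxMr // groupV ccoc_in. Qed.

Lemma ccoc_mul g h i : ccoc (g * h * crep i)%g =
  (ccoc (g * crep (cidx (h * crep i))) * ccoc (h * crep i))%g.
Proof. by rewrite /ccoc cidx_mul !mulgA mulgK. Qed.

Lemma ccoc_crep i : ccoc (crep i) = 1%g.
Proof. by rewrite /ccoc cidx_crep mulVg. Qed.

Fact coset_act1 x : coset_act 1%g x = x.
Proof. by case: x => a i; rewrite /coset_act mul1g cidx_crep ccoc_crep mhom1 addr0. Qed.

Fact coset_actM g h x : coset_act (g * h)%g x = coset_act g (coset_act h x).
Proof.
rewrite /coset_act /= cidx_mul ccoc_mul mhomM ?ccoc_in //.
by rewrite -addrA [X in _ + X]addrC.
Qed.

Fact coset_actA g a x : coset_act g (a + x.1, x.2) = (a + (coset_act g x).1, (coset_act g x).2).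
Proof. by rewrite /coset_act /= addrA. Qed.

Definition coset_fibset : fibset A gT := FibSet coset_act1 coset_actM coset_actA.

Lemma coset_fibset_transitive (x : coset_fibset) :
  exists a g, x = fiber_A a (fiber_G (f := coset_fibset) g (0, cidx 1%g)).
Proof.
case: x => a i; exists (a - mhom p (ccoc (crep i))), (crep i).
by rewrite /= /coset_act /= crep1 mulg1 cidx_crep add0r subrK.
Qed.

Lemma coset_fibset_stab : has_stab (X := coset_fibset) (0, cidx 1%g) p.
Proof.
have stabH g : g \in H ->
    fiber_G (f := coset_fibset) g (0, cidx 1%g) =
    fiber_A (f := coset_fibset) (mhom p g) (0, cidx 1%g).
  move=> gH; rewrite /= /coset_act /= crep1 mulg1 addr0 add0r /ccoc.
  by rewrite -[in cidx g](mul1g g) cidxMr // crep1 invg1 mul1g.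
split=> // g; split=> [[a]|gH]; last by exists (mhom p g); apply: stabH.
rewrite /= /coset_act /= crep1 mulg1 => -[_ /(congr1 enum_val)].
by rewrite !enum_val_cidx mul1g => <-; apply: lcoset_refl.
Qed.

(* CG (x)_{CH} W = (+)_i crep i (x) W in coordinates: [ind_emb i] is the map
   w |-> crep i (x) w, and g * crep i = crep j * h acts by
   g (crep i (x) w) = crep j (x) h w. *)
Section InducedModule.
Variables (C : fieldType) (d : nat) (rW : mx_representation C H d).

Definition ind_emb (i : 'I_ncos) : 'M[C]_(ncos * d, d) :=
  \matrix_(k, l) (k == mxvec_index i l)%:R.

Definition ind_mx g : 'M[C]_(ncos * d) :=
  \sum_i ind_emb (cidx (g * crep i)%g) *m rW (ccoc (g * crep i)%g)
           *m (ind_emb i)^T.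

Lemma mxvec_index_eq (i j : 'I_ncos) (k l : 'I_d) :
  (mxvec_index i k == mxvec_index j l) = (i == j) && (k == l).
Proof.
rewrite -[RHS]
  (inj_eq (inj_comp (@cast_ord_inj _ _ (mxvec_cast ncos d)) enum_rank_inj)
    (i, k) (j, l)).
by [].
Qed.

Lemma ind_embK i j : (ind_emb i)^T *m ind_emb j = (i == j)%:R%:M.
Proof.
apply/matrixP => k l; rewrite !mxE (bigD1 (mxvec_index i k)) //= big1.
  rewrite !mxE eqxx mul1r addr0 mxvec_index_eq.
  by case: eqP => _; rewrite ?mul0rn.
by move=> m /negbTE nm; rewrite !mxE nm mul0r.
Qed.

Lemma ind_emb_sum : \sum_i ind_emb i *m (ind_emb i)^T = 1%:M.
Proof.
apply/matrixP => m1 m2; case/mxvec_indexP: m1 => i k.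
case/mxvec_indexP: m2 => j l; rewrite !mxE summxE (bigD1 i) //= big1.
  rewrite mxE (bigD1 k) //= big1 => [|m nm].
    by rewrite !mxE eqxx mul1r !addr0 eq_sym.
  by rewrite !mxE mxvec_index_eq eqxx eq_sym (negbTE nm) mul0r.
move=> i' ni'; rewrite mxE big1 // => m _.
by rewrite !mxE mxvec_index_eq eq_sym (negbTE ni') mul0r.
Qed.

Lemma ind_mx_emb g i : ind_mx g *m ind_emb i =
  ind_emb (cidx (g * crep i)%g) *m rW (ccoc (g * crep i)%g).
Proof.
rewrite mulmx_suml (bigD1 i) //= big1 => [|j /negbTE nji].
  by rewrite addr0 -mulmxA ind_embK eqxx mulmx1.
by rewrite -mulmxA ind_embK nji raddf0 mulmx0.
Qed.

Lemma ind_mx_ext (M N : 'M[C]_(ncos * d)) :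
  (forall i, M *m ind_emb i = N *m ind_emb i) -> M = N.
Proof.
move=> MN; rewrite -[M]mulmx1 -[N]mulmx1 -ind_emb_sum !mulmx_sumr.
by apply: eq_bigr => i _; rewrite !mulmxA MN.
Qed.

Lemma ind_mx_emb1 h : h \in H ->
  ind_mx h *m ind_emb (cidx 1%g) = ind_emb (cidx 1%g) *m rW h.
Proof.
move=> hH; have e : cidx h = cidx 1%g by rewrite -[in LHS](mul1g h) cidxMr.
by rewrite ind_mx_emb /ccoc crep1 mulg1 e crep1 invg1 mul1g.
Qed.

Fact ind_mx_repr : mx_repr [set: gT]%g ind_mx.
Proof.
split=> [|g h _ _]; apply: ind_mx_ext => i.
  by rewrite ind_mx_emb mul1g cidx_crep ccoc_crep repr_mx1 mulmx1 mul1mx.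
rewrite -mulmxA !ind_mx_emb mulmxA ind_mx_emb cidx_mul ccoc_mul.
by rewrite repr_mxM ?ccoc_in // mulmxA.
Qed.

Definition ind_repr : mx_representation C [set: gT]%g (ncos * d) :=
  MxRepresentation ind_mx_repr.

Definition ind_comp (i : 'I_(norb coset_fibset)) : {vspace 'cV[C]_(ncos * d)} :=
  limg (mxhom (ind_emb i)).

Fact ind_direct : direct_decomp ind_comp.
Proof.
apply: direct_decompP.
  apply/vspaceP => v; rewrite memvf.
  have -> : v = \sum_i mxhom (ind_emb i) ((ind_emb i)^T *m v).
    under eq_bigr do rewrite mxhomE mulmxA.
    by rewrite -mulmx_suml ind_emb_sum mul1mx.
  by apply: memv_sumr => i _; apply: memv_img; apply: memvf.
apply: (@leq_trans (\sum_(i < ncos) d)); last by rewrite sum_nat_const card_ord.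
apply: leq_sum => i _.
by apply: leq_trans (dim_limg_leq _ _) _; rewrite dim_cV.
Qed.

Fact ind_compG g i :
  (mxhom (ind_repr g) @: ind_comp i)%VS = ind_comp (oact g i).
Proof.
rewrite /ind_comp -mxhom_comp ind_mx_emb mxhom_comp; congr (_ @: _)%VS.
set h := ccoc _; have hH : h \in H by apply: ccoc_in.
apply/vspaceP => v; rewrite memvf.
have -> : v = mxhom (rW h) (rW h^-1%g *m v).
  by rewrite mxhomE mulmxA -repr_mxM ?groupV // mulgV repr_mx1 mul1mx.
by apply: memv_img; apply: memvf.
Qed.

Definition ind_mod : grmod C coset_fibset := GrMod ind_direct ind_compG.

Definition ind_cls : DA C A gT := Dcls ind_mod.

End InducedModule.
End Transitive.
End Induction.

Section Idempotents.
Variables (C : numClosedFieldType) (A : zmodType) (gT : finGroupType).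

(* The isomorphism classes of simple CH-modules correspond to the Wedderburn
   components of the regular representation, [irr_repr S] being in the class S.
   mxrepresentation lets matrices act on row vectors, but a matrix
   representation is irreducible on rows iff it is on columns. *)
Definition Irr (H : {group gT}) : irrType C H := DecSocleType (regular_repr C H).

Lemma conj_Zadj (w z : C) : #|gT|.-primitive_root w -> z ^+ #|gT| = 1 ->
  z^* \in Zadj w.
Proof.
move=> hw zN; have N_gt0 := prim_order_gt0 hw.
have [i ->] := prim_rootP hw zN; rewrite rmorphXn rpredX //=.
have nw : `|w| = 1.
  by apply/eqP; rewrite -(pexpr_eq1 N_gt0) // -normrX (prim_expr_order hw) normr1.
suff -> : w^* = w ^+ #|gT|.-1 by rewrite rpredX // Zadj_gen.
have w0 : w != 0 by rewrite -normr_eq0 nw oner_neq0.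
apply: (mulfI w0); rewrite -normCK nw expr1n -exprS prednK //.
by rewrite (prim_expr_order hw).
Qed.

Lemma conj_char_Zadj (w : C) (H : {group gT}) d (rW : mx_representation C H d)
    (h : gT) : #|gT|.-primitive_root w -> h \in H -> (\tr (rW h))^* \in Zadj w.
Proof.
move=> hw hH; case: d rW => [|d] rW.
  by rewrite /mxtrace big_ord0 rmorph0 rpred0.
have [r rE] := closed_field_poly_normal (char_poly (rW h)).
rewrite (monicP (char_poly_monic _)) scale1r in rE.
have sz_r : size r = d.+1.
  by have := size_char_poly (rW h); rewrite rE size_prod_XsubC => -[].
have trE : \tr (rW h) = \sum_(z <- r) z.
  apply: oppr_inj; rewrite -char_poly_trace // rE -coefPn_prod_XsubC ?sz_r //.
rewrite trE rmorph_sum big_seq; apply: rpred_sum => z zr.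
apply: conj_Zadj hw _; have: eigenvalue (rW h) z.
  by rewrite eigenvalue_root_char rE root_prod_XsubC.
case/eigenvalueP => v vE v0.
have vX n : v *m rW (h ^+ n)%g = z ^+ n *: v.
  elim: n => [|n IH]; first by rewrite repr_mx1 mulmx1 scale1r.
  rewrite expgSr repr_mxM ?groupX // mulmxA IH -scalemxAl vE.
  by rewrite scalerA exprSr.
have hN : (h ^+ #|gT|)%g = 1%g by rewrite -cardsT expg_cardG ?inE.
apply/eqP; rewrite -subr_eq0; have := vX #|gT|; rewrite hN repr_mx1 mulmx1.
move/eqP; rewrite -subr_eq0 -[X in X - _]scale1r -scalerBl scaler_eq0.
by rewrite (negbTE v0) orbF -oppr_eq0 opprB.
Qed.

Section Idempotent.
Variables (w : C) (hw : #|gT|.-primitive_root w).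

Definition conj_char (H : {group gT}) d (rW : mx_representation C H d) (h : gT)
    (hH : h \in H) : Zext w := ZExt (conj_char_Zadj rW hw hH).

Definition DAw : zmodType := tensor (Zext w) (DA C A gT).
Definition QDAw : zmodType := tensor rat DAw.

(* Q (x)_Z D_w is Q[w] (x)_Z D, with q (z (x) y) = q (x) (z (x) y); the group
   D_w sits in it through y |-> 1 (x) y. *)
Definition DAw_incl (y : DAw) : QDAw := tens (1 : rat) y.

Definition between (a : gT) (K : {group gT}) : Type :=
  {H : {group gT} | (<[a]>%g \subset H) && (H \subset K)}.

Lemma between_mem a K (H : between a K) : a \in val H.
Proof. by case/andP: (valP H) => + _; rewrite cycle_subG. Qed.

Lemma between_sub a K (H : between a K) : val H \subset K.
Proof. by case/andP: (valP H). Qed.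

Definition fib_idem (p : mpair A gT) (a : gT) : QDAw :=
  tens (#|mnorm p :&: 'C[a]%g|%:R^-1 : rat)
    (\sum_(H : between a (mgrp p)) \sum_(S : Irr (val H))
       let q := mres (between_sub H) in
       tens ((mmoebius q p)%:~R * conj_char (irr_repr S) (between_mem H))
            (ind_cls (p := q) (irr_repr S))).

End Idempotent.
End Idempotents.

(* Main.v *)
(* Write e for the idempotent, N for |N_G(K,psi,a)| and s = N e, an element of
   D_w.  For [X,V] let lambda[X,V] be the dimension of the G-fixed vectors in
   the sum of the V_x over the orbits x whose stabilizer has order |K|.  This is
   additive, so it extends to Q (x) D_w with lambda(D_w) inside Z[w].  By
   Frobenius reciprocity lambda[H,phi,S]_G = dim S^H when |H| = |K|, and it is 0
   otherwise; hence only the term with H = K and S trivial contributes to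
   lambda(s), which is 1.  If m e lies in D_w, then m / N = lambda(m e) is
   rational and in Z[w], hence an integer. *)
Require Import Defs.
From HB Require Import structures.
From mathcomp Require Import all_boot all_order all_fingroup all_algebra.
From mathcomp Require Import generic_quotient ring_quotient pgroup.
From mathcomp Require Import mxrepresentation boolp reals.
From mathcomp Require Import freeg complex.

Set Implicit Arguments.
Unset Strict Implicit.
Unset Printing Implicit Defensive.

Import Order.TTheory GRing.Theory Num.Theory.

Local Open Scope ring_scope.

(** * Rational numbers in the ring generated by a root of unity *)

Lemma rat_integral_int (r : rat) (q : {poly int}) :
  q \is monic -> root (map_poly intr q) r -> exists z : int, r = z%:~R.
Proof.
(* By Gauss's lemma, [q] has an integer factor [p1] proportional to X - r. As [q] is monic, the
   leading coefficient of [p1] is a unit, so [r] is an integer multiple of it. *)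
move=> q_mon; rewrite -dvdp_XsubCl => /dvdpP_rat_int[p1 [b b0 XE] [s qE]].
have u1 : lead_coef p1 \is a GRing.unit.
  apply/unitrP; exists (lead_coef s); rewrite [lead_coef p1 * _]mulrC
    [lead_coef s * _]mulrC -lead_coefM -qE.
  by rewrite (monicP q_mon).
have /(congr1 (fun p : {poly rat} => p`_1)) := XE.
have szp : size p1 = 2.
  rewrite -(size_map_inj_poly (@intr_inj rat) (mulr0z 1)) //.
  by rewrite -(size_scale _ b0) -XE size_XsubC.
have p11 : p1`_1 = lead_coef p1 by rewrite lead_coefE szp.
rewrite coefB coefX coefC subr0 coefZ coef_map /= p11 => b1.
have /(congr1 (fun p : {poly rat} => p`_0)) := XE.
rewrite coefB coefX coefC sub0r coefZ coef_map /= => r0.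
exists (- ((lead_coef p1)^-1 * p1`_0)).
rewrite -[LHS]opprK r0 mulrNz; congr (- _).
rewrite intrM; congr (_ * _); apply: (mulIf (_ : (lead_coef p1)%:~R != 0)).
  by rewrite intr_eq0; apply: contraTneq u1 => ->; rewrite unitr0.
by rewrite -b1 -intrM mulVr.
Qed.

(** Since [w] is a root of the monic X^n - 1, every integer polynomial in [w] is integral over the
    integers; a monic equation for [ratr r] also holds for [r]. *)
Lemma Zadj_rat (F : numFieldType) (w : F) n (r : rat) :
  n.-primitive_root w -> ratr r \in Zadj w -> exists z : int, r = z%:~R.
Proof.
move=> w_prim /asboolP[p rE].
have int_w : integralOver intr w.
  exists ('X^n - 1); first by rewrite -[1]/(1%:P) monicXnsubC //
    (prim_order_gt0 w_prim).
  rewrite rmorphB rmorph1 /= map_polyXn rootE !hornerE.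
  by rewrite (prim_expr_order w_prim) subrr.
have [q q_mon qr] : integralOver intr (ratr r : F).
  rewrite rE; apply: integral_horner int_w; apply/integral_poly => i.
  by rewrite coef_map /=; apply: integral_id.
apply: (rat_integral_int q_mon); rewrite -(fmorph_root (ratr : rat -> F)).
rewrite -map_poly_comp; congr (root _ _): qr.
by apply: eq_map_poly => z; rewrite /= ratr_int.
Qed.

(** * Universal properties of quotients, free groups and tensor products *)

Section ZquotLift.
Variables (M : zmodType) (S : M -> Prop).

Lemma zprojB : {morph zproj S : x y / x - y}.
Proof. by move=> x y; rewrite /zproj; exact: raddfB. Qed.

HB.instance Definition _ :=
  GRing.isZmodMorphism.Build M (zquot S) (zproj S) zprojB.

Lemma zproj_eq0 s : S s -> zproj S s = 0.
Proof.
move=> Ss; rewrite -(raddf0 (zproj S)).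
apply/eqP; rewrite /zproj -Quotient.idealrBE subr0.
by apply/asboolP => P _ _; apply.
Qed.

Variables (N : zmodType) (f : {additive M -> N}).

(** Evaluation at a chosen representative; [zliftE] shows that the choice does not matter once [f]
    kills [S]. *)
Definition zlift (q : zquot S) : N := f (generic_quotient.repr q).

Hypothesis f0 : forall s, S s -> f s = 0.

(** The kernel of [f] is a subgroup containing [S], hence contains the subgroup that [S]
    generates. *)
Lemma zliftE x : zlift (zproj S x) = f x.
Proof.
apply/eqP; rewrite -subr_eq0 /zlift -raddfB; apply/eqP.
have : (generic_quotient.repr (zproj S x) - x) \in subgroup_gen S.
  by rewrite Quotient.idealrBE reprK.
move=> /asboolP/(_ (fun u => f u = 0)); apply=> //; first exact: raddf0.
by move=> u v fu fv; rewrite raddfB fu fv subr0.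
Qed.

Lemma zquotW (q : zquot S) : exists x, q = zproj S x.
Proof. by exists (generic_quotient.repr q); rewrite /zproj reprK. Qed.

Lemma zliftB : {morph zlift : x y / x - y}.
Proof.
move=> x y; have [[u ->] [v ->]] := (zquotW x, zquotW y).
by rewrite -raddfB /= !zliftE raddfB.
Qed.

End ZquotLift.

Section FreeLift.
Variables (K : choiceType) (N : zmodType) (f : K -> N).

Definition fgen_lift : {freeg K} -> N := fglift (f : K -> zmodule N).

Lemma fgen_liftE k : fgen_lift (fgen k) = f k.
Proof. by rewrite /fgen_lift /fgen liftU scale1r. Qed.

Lemma fgen_liftB : {morph fgen_lift : x y / x - y}.
Proof. exact: (@lift_is_additive int K (zmodule N)). Qed.

HB.instance Definition _ :=
  GRing.isZmodMorphism.Build {freeg K} N fgen_lift fgen_liftB.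
End FreeLift.

Section TensorLift.
Variables (U V N : zmodType) (f : U -> V -> N).
Hypothesis fDl : forall u1 u2 v, f (u1 + u2) v = f u1 v + f u2 v.
Hypothesis fDr : forall u v1 v2, f u (v1 + v2) = f u v1 + f u v2.

Definition tensor_lift : tensor U V -> N :=
  zlift (fgen_lift (fun x : U * V => f x.1 x.2)).

Fact tensor_lift_rel s : tensor_rel s ->
  fgen_lift (fun x : U * V => f x.1 x.2) s = 0.
Proof.
by case=> *; rewrite !raddfB /= !fgen_liftE /= ?fDl ?fDr addrAC addrK subrr.
Qed.

Lemma tensor_liftE u v : tensor_lift (tens u v) = f u v.
Proof. exact: etrans (zliftE tensor_lift_rel _) (fgen_liftE _ _). Qed.

Lemma tensor_liftB : {morph tensor_lift : x y / x - y}.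
Proof. exact: zliftB tensor_lift_rel. Qed.
End TensorLift.

Section Tens.
Variables (U V : zmodType).

Lemma tensDl (u1 u2 : U) (v : V) : tens (u1 + u2) v = tens u1 v + tens u2 v.
Proof.
apply/eqP; rewrite -subr_eq0 opprD addrA /tens -!raddfB; apply/eqP.
exact/zproj_eq0/TensorDl.
Qed.

Lemma tens_Mnl (u : U) (v : V) n : tens (u *+ n) v = tens u v *+ n.
Proof.
elim: n => [|n IH]; last by rewrite !mulrS tensDl IH.
by apply: (addrI (tens 0 v)); rewrite -tensDl mulr0n !addr0.
Qed.
End Tens.

(** * Fixed vectors of representations *)

Section FixedVectors.
Variables (C : fieldType) (gT : finGroupType).

Definition fixv (H : {set gT}) d (r : mx_representation C H d) :
    {vspace 'cV[C]_d} := (\bigcap_(g in H) fixedSpace (mxhom (r g)))%VS.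

Lemma fixvP (H : {set gT}) d (r : mx_representation C H d) v :
  reflect {in H, forall g, r g *m v = v} (v \in fixv r).
Proof.
rewrite memvE; apply: (iffP subv_bigcapP) => fv g gH.
  by move: (fv g gH); rewrite -memvE => /fixedSpaceP; rewrite mxhomE.
by rewrite -memvE; apply/fixedSpaceP; rewrite mxhomE fv.
Qed.

Lemma dim_limg_mxhom m n (M : 'M[C]_(m, n)) (N : 'M[C]_(n, m)) U :
  N *m M = 1%:M -> \dim (mxhom M @: U) = \dim U.
Proof.
move=> NM; apply: limg_dim_eq; suff /eqP-> : lker (mxhom M) == 0%VS.
  by rewrite capv0.
apply/lker0P => u v; rewrite !mxhomE => /(congr1 (mulmx N)).
by rewrite !mulmxA NM !mul1mx.
Qed.

(** The action is blockwise, so a stacked vector is fixed iff both of its blocks are. Additivity for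
    both [psum] and [msum] comes from this formula. *)
Lemma dim_fixv_dsum m n (rV : mx_representation C [set: gT]%g m)
    (rW : mx_representation C [set: gT]%g n) U1 U2 :
  \dim ((mxhom (dsum_inl C m n) @: U1 + mxhom (dsum_inr C m n) @: U2)
        :&: fixv (dsum_repr rV rW))%VS
  = (\dim (U1 :&: fixv rV) + \dim (U2 :&: fixv rW))%N.
Proof.
have lK : row_mx 1%:M 0 *m dsum_inl C m n = 1%:M.
  by rewrite mul_row_col mulmx1 mul0mx addr0.
have rK : row_mx 0 1%:M *m dsum_inr C m n = 1%:M.
  by rewrite mul_row_col mulmx1 mulmx0 add0r.
have lE (u : 'cV_m) : mxhom (dsum_inl C m n) u = col_mx u 0.
  by rewrite mxhomE mul_col_mx mul1mx mul0mx.
have rE (u : 'cV_n) : mxhom (dsum_inr C m n) u = col_mx 0 u.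
  by rewrite mxhomE mul_col_mx mul1mx mul0mx.
have lrE (u : 'cV_m) (v : 'cV_n) :
    mxhom (dsum_inl C m n) u + mxhom (dsum_inr C m n) v = col_mx u v.
  by rewrite lE rE add_col_mx addr0 add0r.
have dE g (u : 'cV_m) (v : 'cV_n) :
    dsum_repr rV rW g *m col_mx u v = col_mx (rV g *m u) (rW g *m v).
  by rewrite mul_block_col !mul0mx addr0 add0r.
set L := mxhom _ in lE lrE *; set T := mxhom _ in rE lrE *.
have -> : ((L @: U1 + T @: U2) :&: fixv (dsum_repr rV rW)
           = L @: (U1 :&: fixv rV) + T @: (U2 :&: fixv rW))%VS.
  apply/vspaceP => v; apply/memv_capP/memv_addP => [[]|].
    case/memv_addP=> _ /memv_imgP[u1 u1U ->] [_ /memv_imgP[u2 u2U ->] ->].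
    rewrite lrE => /fixvP fu.
    have fu12 g : rV g *m u1 = u1 /\ rW g *m u2 = u2.
      by apply: eq_col_mx; rewrite -dE fu ?inE.
    exists (L u1); last (exists (T u2); last by rewrite lrE).
      by apply/memv_img/memv_capP; split=> //; apply/fixvP => g _; case: (fu12 g).
    by apply/memv_img/memv_capP; split=> //; apply/fixvP => g _; case: (fu12 g).
  case=> _ /memv_imgP[u1 /memv_capP[u1U /fixvP u1F] ->].
  case=> _ /memv_imgP[u2 /memv_capP[u2U /fixvP u2F] ->] ->.
  split; first by apply: memv_add; apply: memv_img.
  by rewrite lrE; apply/fixvP => g gG; rewrite dE u1F ?u2F.
rewrite dimv_disjoint_sum ?(dim_limg_mxhom _ lK) ?(dim_limg_mxhom _ rK) //.
apply/eqP; rewrite -subv0; apply/subvP => v /memv_capP[].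
move=> /memv_imgP[u1 _ ->] /memv_imgP[u2 _]; rewrite lE rE.
by case/eq_col_mx => -> _; rewrite memv0 col_mx0.
Qed.

(* Irreducibility is about row submodules: the one used here is [kermx u], for
   a fixed column vector [u]. *)
Lemma irr_fixv (H : {group gT}) d (r : mx_representation C H d) :
  mx_irreducible r -> fixv r != 0%VS ->
  d = 1%N /\ {in H, forall h, r h = 1%:M}.
Proof.
move=> /mx_irrP[d_gt0 r_irr] fix_n0.
have u0 : vpick (fixv r) != 0 by rewrite vpick0.
have /fixvP fu := memv_pick (fixv r); move: (vpick _) fu u0 => u fu u0.
have ker0 : kermx u == 0.
  apply: contraNT u0 => ker_n0; have := r_irr (kermx u) _ ker_n0.
  rewrite -sub1mx sub_kermx mul1mx; apply.
  apply/mxmoduleP => h hH; rewrite sub_kermx -mulmxA fu //.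
  exact/eqP/mulmx_ker.
(* A trivial row kernel gives [u] rank [d], while a single column has rank at most 1. *)
have d1 : d = 1%N.
  have := rank_leq_col u; have := mxrank_ker u; rewrite (eqP ker0) mxrank0.
  move/esym/eqP; rewrite subn_eq0 => le1 le2.
  by apply/eqP; rewrite eqn_leq d_gt0 (leq_trans le1).
clear r_irr ker0 d_gt0 fix_n0; split=> // h hH; move: u fu u0.
case: d / {d1}(esym d1) r => r u fu u0.
have := fu h hH; rewrite [r h]mx11_scalar mul_scalar_mx => /eqP.
rewrite -subr_eq0 -[X in _ - X]scale1r -scalerBl scaler_eq0 (negbTE u0) orbF.
by rewrite subr_eq0 => /eqP->.
Qed.

End FixedVectors.

(** * Fixed vectors supported on orbits with stabilizers of a given order *)

Section FixDim.
Variables (C : fieldType) (A : zmodType) (gT : finGroupType) (k : nat).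

Definition ostab (X : fibset A gT) (i : 'I_(norb X)) : {set gT} :=
  [set g | oact g i == i].

(** The order of a stabilizer is invariant under conjugation and isomorphism, and among the
    subgroups of [K] the order of [K] singles out [K]. *)
Definition stab_part (X : fibset A gT) (V : grmod C X) :
    {vspace 'cV[C]_(gdim V)} :=
  (\sum_(i | #|ostab i| == k) gcomp V i)%VS.

Definition fixdim (P : grpair C A gT) : nat :=
  \dim (stab_part (gmod P) :&: fixv (grep (gmod P))).

(** If g x = a x for some a in [A], then equivariance gives g f(x) = a f(x). *)
Lemma ostab_mor (X Y : fibset A gT) (f : fibered_mor X Y) (x : X) :
  ostab x.2 \subset ostab (f x).2.
Proof.
apply/subsetP => g; rewrite !inE -!oactE => /eqP gx; apply/eqP.
have gE : fact g x = fiber_A (f := X) ((fact g x).1 - x.1) x.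
  by rewrite /= subrK [LHS]surjective_pairing gx.
by have := fibered_funG f g x; rewrite /= gE fibered_funA => <-.
Qed.

Lemma fixdim_iso_leq (P Q : grpair C A gT) :
  grpair_iso P Q -> (fixdim P <= fixdim Q)%N.
Proof.
case=> f [f' [fK f'K MK _]]; set M := mor_mod f in MK.
rewrite /fixdim -(dim_limg_mxhom _ MK); apply: dimvS.
apply/subvP => _ /memv_imgP[v /memv_capP[vU /fixvP vF] ->].
apply/memv_capP; split; last first.
  by apply/fixvP => g gG; rewrite mxhomE mulmxA -mor_modG -mulmxA vF.
apply: subvP (memv_img _ vU); rewrite limg_sum; apply/subv_sumP => i /eqP ki.
pose x : gset P := (0, i); apply: subv_trans (mor_comp f x) _.
(* The orbit of the image is selected too: stabilizers can only grow under [f] and under its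
   inverse, so their orders agree. *)
apply: (sumv_sup (mor_set f x).2) => //; rewrite -ki eqn_leq.
have := ostab_mor (mor_set f') (mor_set f x); rewrite fK => /subset_leq_card-> /=.
exact: subset_leq_card (ostab_mor (mor_set f) x).
Qed.

Lemma fixdim_iso (P Q : grpair C A gT) : grpair_iso P Q -> fixdim P = fixdim Q.
Proof.
move=> isoPQ; apply/eqP; rewrite eqn_leq !fixdim_iso_leq //.
by case: isoPQ => f [f' [? ? ? ?]]; exists f', f.
Qed.

Lemma fixdim_psum (P Q : grpair C A gT) :
  fixdim (psum P Q) = (fixdim P + fixdim Q)%N.
Proof.
rewrite /fixdim -dim_fixv_dsum; congr (\dim (_ :&: _)%VS).
(* The filter on orbits is moved into the terms so that the index range can be split between the two
   sets, then restored. *)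
rewrite /stab_part [LHS]big_mkcond big_split_ord -!big_mkcond /= !limg_sum.
have cardl i : #|ostab (X := fsum (gset P) (gset Q)) (lshift _ i)| = #|ostab i|.
  congr #|pred_of_set _|; apply/setP => g.
  by rewrite !inE oact_lshift (inj_eq (@lshift_inj _ _)).
have cardr i : #|ostab (X := fsum (gset P) (gset Q)) (rshift _ i)| = #|ostab i|.
  congr #|pred_of_set _|; apply/setP => g.
  by rewrite !inE oact_rshift (inj_eq (@rshift_inj _ _)).
congr (_ + _)%VS; apply: eq_big => i; rewrite ?cardl ?cardr // /psum_comp => _.
  by rewrite (unsplitK (inl i)).
by rewrite (unsplitK (inr i)).
Qed.

Lemma fixdim_msum (X : fibset A gT) (V W : grmod C X) :
  fixdim (GrPair (msum V W)) = (fixdim (GrPair V) + fixdim (GrPair W))%N.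
Proof.
rewrite /fixdim -dim_fixv_dsum; congr (\dim (_ :&: _)%VS).
by rewrite /stab_part big_split /= !limg_sum.
Qed.

End FixDim.

(** * Fixed vectors of induced modules *)

Section InducedFixDim.
Variables (C : fieldType) (A : zmodType) (gT : finGroupType) (p : mpair A gT).
Variables (d : nat) (rW : mx_representation C (mgrp p) d).
Local Notation H := (mgrp p).
Local Notation ind_emb := (@ind_emb A gT p C d).

(** The stabilizer of the coset x H is the conjugate x H x^-1. *)
Lemma card_ostab_coset (i : 'I_(ncos p)) :
  #|ostab (X := coset_fibset p) i| = #|H|.
Proof.
rewrite -(cardJg H (crep i)^-1)%g; congr #|pred_of_set _|; apply/setP => g.
rewrite inE mem_conjgV /oact /= conjgE; apply/eqP/idP => [gi|gH].
  by have := ccoc_in p (g * crep i)%g; rewrite /ccoc gi ?mulgA.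
rewrite -[RHS]cidx_crep -(cidxMr (crep i) gH); congr cidx.
by rewrite mulKVg.
Qed.

Lemma cidx_act_inj g : injective (fun i : 'I_(ncos p) => cidx p (g * crep i)).
Proof.
apply: (can_inj (g := fun j : 'I_(ncos p) => cidx p (g^-1 * crep j))) => i.
by rewrite -cidx_mul mulVg mul1g cidx_crep.
Qed.

(** The transpose of [ind_emb] projects onto one summand. Since [g] permutes the cosets, each block
    row of its matrix has a single nonzero block; this is the row counterpart of [ind_mx_emb]. *)
Lemma ind_embK_mx g i :
  (ind_emb (cidx p (g * crep i)))^T *m ind_mx rW g =
  rW (ccoc p (g * crep i)) *m (ind_emb i)^T.
Proof.
rewrite mulmx_sumr (bigD1 i) //= big1 => [|j ji].
  by rewrite addr0 !mulmxA ind_embK eqxx mul1mx.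
rewrite !mulmxA ind_embK (_ : _ == _ = false) ?raddf0 ?mul0mx //.
by apply: contraNF ji => /eqP/cidx_act_inj->.
Qed.

(** The map sending u to the sum of all [crep i] (x) u. *)
Definition ind_diag : 'M[C]_(ncos p * d, d) := \sum_i ind_emb i.

Lemma ind_diagK : (ind_emb (cidx p 1%g))^T *m ind_diag = 1%:M.
Proof.
rewrite mulmx_sumr (bigD1 (cidx p 1%g)) //= big1 => [|j ji].
  by rewrite addr0 ind_embK eqxx.
by rewrite ind_embK eq_sym (negbTE ji) raddf0.
Qed.

(* Frobenius reciprocity for the trivial module. *)
Lemma fixv_ind : fixv (ind_repr rW) = (mxhom ind_diag @: fixv rW)%VS.
Proof.
have emb1K h : h \in H -> (ind_emb (cidx p 1%g))^T *m ind_mx rW h =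
    rW h *m (ind_emb (cidx p 1%g))^T.
  move=> hH; have := ind_embK_mx h (cidx p 1%g).
  by rewrite crep1 mulg1 /ccoc -[in cidx p h](mul1g h) cidxMr //
    crep1 invg1 mul1g.
apply/vspaceP => v; apply/fixvP/memv_imgP => [fv|[u /fixvP fu ->] g _]; last first.
  rewrite !mxhomE mulmxA mulmx_sumr [LHS]mulmx_suml [RHS]mulmx_suml.
  under eq_bigr do rewrite ind_mx_emb -mulmxA fu ?ccoc_in //.
  by rewrite [RHS](reindex_inj (@cidx_act_inj g)).
(* A fixed vector is determined by its component at the trivial coset. *)
pose u := (ind_emb (cidx p 1%g))^T *m v.
exists u; first by apply/fixvP => h hH; rewrite mulmxA -emb1K // -mulmxA fv ?inE.
rewrite mxhomE mulmx_suml -[LHS]mul1mx -(ind_emb_sum p C d) mulmx_suml.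
apply: eq_bigr => i _; rewrite -mulmxA; congr (_ *m _).
(* Acting by [crep i] carries the component at the trivial coset to the one at [i], so all
   components of the fixed [v] equal [u]. *)
have := ind_embK_mx (crep i) (cidx p 1%g).
rewrite crep1 mulg1 cidx_crep ccoc_crep repr_mx1 mul1mx => /(congr1 (mulmx^~ v)).
by rewrite -mulmxA fv ?inE.
Qed.

(** All orbits have stabilizers of order |H|, so the selected part is the whole induced module or
    zero. *)
Lemma fixdim_ind k :
  fixdim k (GrPair (ind_mod rW)) = if #|H| == k then \dim (fixv rW) else 0%N.
Proof.
rewrite /fixdim /stab_part.
under eq_bigl do rewrite card_ostab_coset.
case: eqP => _; last by rewrite big_pred0_eq cap0v dimv0.
rewrite (gcomp_full (ind_mod rW)) capfv /= fixv_ind.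
exact: dim_limg_mxhom ind_diagK.
Qed.

End InducedFixDim.

(** * The resulting functional on the Grothendieck groups and its scalar extensions *)

Section FixMultiplicity.
Variables (C : fieldType) (A : zmodType) (gT : finGroupType) (k : nat).

Definition fixfree : {freeg {classic grpair C A gT}} -> int :=
  fgen_lift (fun P : {classic grpair C A gT} => (fixdim k P)%:Z).
HB.instance Definition _ := GRing.isZmodMorphism.Build
  {freeg {classic grpair C A gT}} int fixfree (fgen_liftB _).

Fact fixfree_rel s : T_rel s -> fixfree s = 0.
Proof.
case=> P Q => [isoPQ|]; rewrite !raddfB /= /fixfree !fgen_liftE.
  by rewrite (fixdim_iso k isoPQ) subrr.
by rewrite fixdim_psum PoszD addrAC addrK subrr.
Qed.

Definition fixT : TA C A gT -> int := zlift fixfree.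

Fact fixT_zmod : {morph fixT : x y / x - y}.
Proof. exact: zliftB fixfree_rel. Qed.
HB.instance Definition _ :=
  GRing.isZmodMorphism.Build (TA C A gT) int fixT fixT_zmod.

Lemma fixT_cls (X : fibset A gT) (V : grmod C X) :
  fixT (Tcls V) = fixdim k (GrPair V).
Proof. exact: etrans (zliftE fixfree_rel _) (fgen_liftE _ _). Qed.

Fact fixT_rel s : D_rel s -> fixT s = 0.
Proof.
case=> X V W; rewrite !raddfB /= !fixT_cls fixdim_msum PoszD.
by rewrite addrAC addrK subrr.
Qed.

Definition fixD : DA C A gT -> int := zlift fixT.

Fact fixD_zmod : {morph fixD : x y / x - y}.
Proof. exact: zliftB fixT_rel. Qed.
HB.instance Definition _ :=
  GRing.isZmodMorphism.Build (DA C A gT) int fixD fixD_zmod.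

Lemma fixD_cls (X : fibset A gT) (V : grmod C X) :
  fixD (Dcls V) = fixdim k (GrPair V).
Proof. exact: etrans (zliftE fixT_rel _) (fixT_cls V). Qed.

End FixMultiplicity.

Section Extension.
Variables (C : numClosedFieldType) (A : zmodType) (gT : finGroupType).
Variables (w : C) (k : nat).

(** Taking values in [Zext w] rather than in [C] records that the functional is integral on
    [DAw]. *)
Definition fixDw : DAw A gT w -> Zext w :=
  tensor_lift (fun (z : Zext w) (x : DA C A gT) => z *~ fixD k x).

Fact fixDw_linl (z1 z2 : Zext w) (x : DA C A gT) :
  (z1 + z2) *~ fixD k x = z1 *~ fixD k x + z2 *~ fixD k x.
Proof. exact: mulrzDl. Qed.

Fact fixDw_linr (z : Zext w) (x1 x2 : DA C A gT) :
  z *~ fixD k (x1 + x2) = z *~ fixD k x1 + z *~ fixD k x2.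
Proof. by rewrite raddfD mulrzDr. Qed.

Fact fixDw_zmod : {morph fixDw : x y / x - y}.
Proof. exact: tensor_liftB fixDw_linl fixDw_linr. Qed.
HB.instance Definition _ :=
  GRing.isZmodMorphism.Build (DAw A gT w) (Zext w) fixDw fixDw_zmod.

Lemma fixDw_tens z x : fixDw (tens z x) = z *~ fixD k x.
Proof. exact: tensor_liftE fixDw_linl fixDw_linr _ _. Qed.

Definition fixQDw : QDAw A gT w -> C :=
  tensor_lift (fun (q : rat) (y : DAw A gT w) => ratr q * val (fixDw y)).

Fact fixQDw_linl (q1 q2 : rat) (y : DAw A gT w) :
  ratr (q1 + q2) * val (fixDw y) =
    ratr q1 * val (fixDw y) + ratr q2 * val (fixDw y).
Proof. by rewrite rmorphD mulrDl. Qed.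

Fact fixQDw_linr (q : rat) (y1 y2 : DAw A gT w) :
  ratr q * val (fixDw (y1 + y2)) =
    ratr q * val (fixDw y1) + ratr q * val (fixDw y2).
Proof. by rewrite !raddfD mulrDr. Qed.

Lemma fixQDw_tens q y : fixQDw (tens q y) = ratr q * val (fixDw y).
Proof. exact: tensor_liftE fixQDw_linl fixQDw_linr _ _. Qed.

End Extension.

(** * Fixed vectors of simple modules *)

Section Irreducible.
Variables (C : numClosedFieldType) (gT : finGroupType) (H : {group gT}).

Lemma rsim_triv m n (r : mx_representation C H m)
    (s : mx_representation C H n) :
  m = n -> {in H, forall h, r h = 1%:M} -> {in H, forall h, s h = 1%:M} ->
  mx_rsim r s.
Proof.
move=> mn; case: n / mn s => s r1 s1.
exists 1%:M => //; first by rewrite row_free_unit unitmx1.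
by move=> h hH; rewrite r1 ?s1.
Qed.

Lemma fixv_irr1 : fixv (irr_repr (principal_comp (Irr C H))) = fullv.
Proof.
apply/vspaceP => v; rewrite memvf; apply/fixvP => h hH.
by rewrite irr1_repr // mul1mx.
Qed.

Lemma irr_degree1 : irr_degree (principal_comp (Irr C H)) = 1%N.
Proof.
apply: (irr_fixv (socle_irr _) _).1.
by rewrite [fixv _]fixv_irr1 -dimv_eq0 dim_cV -lt0n irr_degree_gt0.
Qed.

(** A simple module with a nonzero fixed vector is one-dimensional and trivial, hence similar to the
    principal component; in characteristic zero similar components coincide. *)
Lemma dim_fixv_irr (S : Irr C H) :
  \dim (fixv (irr_repr S)) = (S == principal_comp _).
Proof.
have charH : ([pchar C]^'.-group H)%g.
  by apply/pgroupP => p p_pr _; rewrite inE /= pchar_num.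
case: eqP => [->|S1]; first by rewrite fixv_irr1 dim_cV irr_degree1.
apply/eqP; rewrite dimv_eq0; apply/negPn/negP.
move=> /(irr_fixv (socle_irr S))[d1 rS].
apply: S1; rewrite -[LHS](irr_reprK_pchar charH) -[RHS](irr_reprK_pchar charH).
apply: (irr_comp_rsim_pchar _ charH); apply: rsim_triv => //.
  exact: etrans d1 (esym irr_degree1).
by move=> h; exact: irr1_repr.
Qed.
End Irreducible.

(** * Evaluation at the idempotent, and the conductor *)

Section Conductor.
Variables (C : numClosedFieldType) (A : zmodType) (gT : finGroupType).
Variables (w : C) (hw : #|gT|.-primitive_root w) (p : mpair A gT) (a : gT).
Local Notation K := (mgrp p).

Lemma tnormE : tnorm p a = mnorm p :&: 'C[a]%g.
Proof.
apply/setP => g; rewrite [LHS]inE 2!inE cent1E; congr (_ && _).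
by rewrite -(inj_eq (mulIg g)) mulgKV.
Qed.

Definition fib_sum : DAw A gT w :=
  \sum_(H : between a K) \sum_(S : Irr C (val H))
    let q := mres (between_sub H) in
    tens ((mmoebius q p)%:~R * conj_char hw (irr_repr S) (between_mem H))
         (ind_cls (p := q) (irr_repr S)).

Lemma fib_idemE : fib_idem hw p a = tens (#|tnorm p a|%:R^-1 : rat) fib_sum.
Proof. by rewrite tnormE. Qed.

Lemma fixDw_fib_sum : a \in K -> fixDw #|K| fib_sum = 1.
Proof.
move=> aK; have betK : (<[a]>%g \subset K) && (K \subset K).
  by rewrite cycle_subG aK subxx.
rewrite raddf_sum (bigD1 (exist _ K betK : between a K)) //=.
rewrite [X in _ + X]big1 => [|H HK].
  rewrite addr0 raddf_sum (bigD1 (principal_comp _)) //= big1 => [|S S1].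
    rewrite addr0 fixDw_tens fixD_cls fixdim_ind eqxx dim_fixv_irr eqxx mulr1z.
    (* Restricting to the whole of [K] gives back [p], so the Moebius coefficient is the diagonal
       value 1. *)
    rewrite (_ : mres _ = p) ?mmoebiusE ?eqxx ?mul1r; last first.
      by apply: mpair_eqP => // x xK; rewrite ffunE xK.
    apply: val_inj; rewrite /= irr1_repr ?irr_degree1 // mxtrace1.
    by rewrite rmorph1.
  by rewrite fixDw_tens fixD_cls fixdim_ind eqxx dim_fixv_irr (negbTE S1).
rewrite raddf_sum big1 //= => S _; rewrite fixDw_tens fixD_cls fixdim_ind /=.
(* A subgroup of [K] with the order of [K] is [K] itself, so every other term vanishes. *)
rewrite ifN ?mulr0z //; apply: contra HK => /eqP cardH.
apply/eqP/val_inj/val_inj/eqP => /=; rewrite eqEcard cardH leqnn andbT.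
exact: between_sub.
Qed.

End Conductor.

Theorem theorem6p3 (R : realType) (A : zmodType) (gT : finGroupType)
    (w : R[i]) (hw : #|gT|.-primitive_root w)
    (Kpsi : mpair A gT) (a : gT) (ha : a \in mgrp Kpsi) :
  is_conductor (@DAw_incl R[i] A gT w) (fib_idem hw Kpsi a) #|tnorm Kpsi a|.
Proof.
have N_gt0 : (0 < #|tnorm Kpsi a|)%N.
  apply/card_gt0P; exists 1%g; rewrite inE mul1g invg1 mulg1 eqxx andbT.
  apply/eqP/mpair_eqP => /= [|x xK].
    by apply/val_inj; rewrite /= invg1 conjsg1.
  by rewrite ffunE xK conjg1.
have N_neq0 : #|tnorm Kpsi a|%:R != 0 :> rat by rewrite pnatr_eq0 -lt0n.
rewrite fib_idemE; split=> // [|m m_gt0 [y yE]].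
  (* Multiplying by the order of the stabilizer cancels the denominator and leaves the sum
     itself. *)
  exists (fib_sum hw Kpsi a).
  by rewrite -tens_Mnl -[X in tens X _]mulr_natr mulVf.
have := congr1 (fixQDw #|mgrp Kpsi|) yE.
rewrite -tens_Mnl !fixQDw_tens fixDw_fib_sum // mulr1 rmorph1 mul1r => rE.
have [z zE] : exists z : int, (#|tnorm Kpsi a|%:R^-1 *+ m : rat) = z%:~R.
  by apply: (Zadj_rat hw); rewrite rE; apply: valP.
(* Clearing the denominator makes [m] a multiple of the stabilizer order; positivity of [m] forces
   [z] to be at least 1. *)
have {}zE : m%:Z = z * #|tnorm Kpsi a|.
  by apply: (@intr_inj rat); rewrite intrM -zE mulrnAl mulVf.
have z_gt0 : 0 < z.
  by rewrite -(pmulr_lgt0 z (_ : 0 < #|tnorm Kpsi a|%:Z)) // -zE.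
by rewrite -lez_nat zE -[X in X <= _]mul1r ler_wpM2r.
Qed.
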